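(* Let $\mathcal{X},\mathcal{Y}$ be finite sets, let $p(x,y)$ be any probability distribution on $\mathcal{X}\times\mathcal{Y}$, and let $\delta\in(0,1)$. Let $\hat p(x,y)$ be the empirical distribution of $m$ i.i.d. samples drawn from $p(x,y)$. Then, with probability at least $1-\delta$ over the draw of the sample, the following holds for all representations $T$ (i.e. for all finite sets $\mathcal{T}$ and all encoders $p(t|x)$ from $\mathcal{X}$ to $\mathcal{T}$) satisfying, with $D=\frac{2+\sqrt{2\log((|\mathcal{Y}|+2)/\delta)}}{\sqrt m}$, the sample-size constraints $$\frac{D}{\sqrt{\min_x p(x)}}\le 1,\qquad \frac{D}{\sqrt{\min_x p(x)}}\sqrt{(1-p(t))p(t)}\le \frac1e,\qquad \frac{D}{\sqrt{\min_x p(x|y)}}\le 1,\qquad \frac{D}{\sqrt{\min_x p(x|y)}}\sqrt{p(t|y)(1-p(t|y))}\le \frac1e$$ for all $t\in\mathcal{T}$ and all $y\in\mathcal{Y}$ (with $p(y)>0$): $$|I(Y;T)-\hat I(Y;T)|\le \frac{1}{\sqrt m}\left((C_1+C_3)\sqrt{|\mathcal{T}|-1}+C_2H(T)+C_4H(T|Y)+C_5\sqrt{(\log|\mathcal{T}|-\hat H(T|Y))\,\hat H(T|Y)}\right),$$ where $C_1,C_2,C_3,C_4,C_5$ depend only on $\delta$, $|\mathcal{Y}|$, $\min_{x,y}p(x|y)$, $\min_{t,y}p(t|y)$, $\min_x p(x)$ and $\min_t p(t)$.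
   Context: All logarithms are natural. $X,Y,T$ take values in finite sets $\mathcal{X},\mathcal{Y},\mathcal{T}$, and $Y\leftrightarrow X\leftrightarrow T$ is a Markov chain: $T$ is generated from $X$ by the encoder $p(t|x)$, so that the joint law is $p(x,y)p(t|x)$. Thus $p(t)=\sum_x p(t|x)p(x)$ and $p(t|y)=\sum_x p(t|x)p(x|y)$. $H$ and $I$ denote Shannon entropy and mutual information under this joint law; $H(T|Y)=\sum_y p(y)H(T|y)$, where $H(T|y)$ is the entropy of $p(\cdot|y)$ on $\mathcal{T}$. Hatted quantities $\hat I,\hat H$ are the same quantities computed with $p(x,y)$ replaced by the empirical distribution $\hat p(x,y)$ of the sample while keeping the encoder $p(t|x)$ the same: the joint law is then $\hat p(x,y)p(t|x)$, $\hat p(t)=\sum_x p(t|x)\hat p(x)$, $\hat p(t|y)=\sum_x p(t|x)\hat p(x|y)$, $\hat H(T|Y)=\sum_y\hat p(y)\hat H(T|y)$. Every minimum ($\min_x p(x)$, $\min_x p(x|y)$, $\min_{x,y}p(x|y)$, $\min_t p(t)$, $\min_{t,y}p(t|y)$) denotes the minimum over nonzero values. ''$C_i$ depend only on ...'' means that they are given by functions of the listed quantities. *)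

(* Defs.v *)
From mathcomp Require Import all_boot all_order all_algebra.
From mathcomp Require Import boolp reals sequences exp.

Set Implicit Arguments.
Unset Strict Implicit.
Unset Printing Implicit Defensive.

Import Order.TTheory GRing.Theory Num.Theory.

Local Open Scope ring_scope.

(* Two totality conventions are used throughout: [ln 0 = 0] and [a / 0 = 0].  *)
(* Hence [0 * ln 0 = 0] in entropies, and a conditional law given an event of *)
(* probability 0 is identically 0.                                            *)

Definition is_distr (R : realType) (A : finType) (f : A -> R) : Prop :=
  (forall a, 0 <= f a) /\ \sum_a f a = 1.

(* [w x t] is p(t|x). *)
Definition is_encoder (R : realType) (X T : finType) (w : X -> T -> R) : Prop :=
  forall x, is_distr (w x).

(* Minimum over the nonzero values of [f]. It is only applied to (conditional) *)
(* probabilities, which are at most 1 and not all 0, so the default value 1    *)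
(* does not affect the result.                                                 *)
Definition min_nz (R : realType) (A : finType) (f : A -> R) : R :=
  \big[Num.min/1]_(a | f a != 0) f a.

Definition entropy (R : realType) (A : finType) (f : A -> R) : R :=
  - \sum_a f a * ln (f a).

Definition mutual_info (R : realType) (A B : finType) (r : A -> B -> R) : R :=
  \sum_a \sum_b
    r a b * ln (r a b / ((\sum_b' r a b') * (\sum_a' r a' b))).

(* Below, [q] is a joint law on X * Y: the true law or an empirical one. *)

Definition margX (R : realType) (X Y : finType) (q : X * Y -> R) (x : X) : R :=
  \sum_y q (x, y).

Definition margY (R : realType) (X Y : finType) (q : X * Y -> R) (y : Y) : R :=
  \sum_x q (x, y).

(* q(x|y) *)
Definition condXY (R : realType) (X Y : finType) (q : X * Y -> R)
    (x : X) (y : Y) : R :=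
  q (x, y) / margY q y.

(* q(t) *)
Definition lawT (R : realType) (X Y T : finType) (q : X * Y -> R)
    (w : X -> T -> R) (t : T) : R :=
  \sum_x w x t * margX q x.

(* q(t|y) *)
Definition condTY (R : realType) (X Y T : finType) (q : X * Y -> R)
    (w : X -> T -> R) (t : T) (y : Y) : R :=
  \sum_x w x t * condXY q x y.

(* q(y,t) under the joint law q(x,y)p(t|x), i.e. Y <-> X <-> T is Markov *)
Definition jointYT (R : realType) (X Y T : finType) (q : X * Y -> R)
    (w : X -> T -> R) (y : Y) (t : T) : R :=
  \sum_x q (x, y) * w x t.

Definition H_T (R : realType) (X Y T : finType) (q : X * Y -> R)
    (w : X -> T -> R) : R :=
  entropy (lawT q w).

Definition H_TY (R : realType) (X Y T : finType) (q : X * Y -> R)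
    (w : X -> T -> R) : R :=
  \sum_y margY q y * entropy (fun t => condTY q w t y).

Definition I_YT (R : realType) (X Y T : finType) (q : X * Y -> R)
    (w : X -> T -> R) : R :=
  mutual_info (jointYT q w).

Definition empirical (R : realType) (A : finType) (m : nat)
    (s : {ffun 'I_m -> A}) (a : A) : R :=
  #|[set i | s i == a]|%:R / m%:R.

(* Probability of the event [E] when s_0, ..., s_(m-1) are i.i.d. with law p: *)
(* the mass of [E] under the m-fold product of p.                             *)
Definition iid_pr (R : realType) (A : finType) (p : A -> R) (m : nat)
    (E : {ffun 'I_m -> A} -> Prop) : R :=
  \sum_(s : {ffun 'I_m -> A} | `[< E s >]) \prod_(i < m) p (s i).

Definition dev (R : realType) (delta : R) (nY m : nat) : R :=
  (2 + Num.sqrt (2 * ln ((nY%:R + 2) / delta))) / Num.sqrt m%:R.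

Definition sample_size_ok (R : realType) (X Y T : finType) (p : X * Y -> R)
    (w : X -> T -> R) (D : R) : Prop :=
  forall (t : T) (y : Y), 0 < margY p y ->
    let a := D / Num.sqrt (min_nz (margX p)) in
    let b := D / Num.sqrt (min_nz (fun x => condXY p x y)) in
    [/\ a <= 1,
        a * Num.sqrt ((1 - lawT p w t) * lawT p w t) <= (expR 1)^-1,
        b <= 1
      & b * Num.sqrt (condTY p w t y * (1 - condTY p w t y)) <= (expR 1)^-1].

(* Main.v *)
(** The constants may depend on delta and on the minima of the laws, so a
second-moment bound is enough. The squared l2 distance between p and the
empirical law has expectation at most 1/m, hence by Markov it is at most
1/(m delta) outside an event of probability delta; as p(x,y) has at most
|Y| / min p(x) atoms, their l1 distance is then O(1/sqrt m). Almost surely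
the empirical law is absolutely continuous with respect to p, so only values of
p(t) and p(t|y) bounded below by their minima matter: there x ln x is Lipschitz,
and I(Y;T) = H(T) - H(T|Y) is Lipschitz in p for the l1 distance, uniformly over
encoders because an encoder contracts it. For |T| > 1 the factor sqrt(|T|-1) is
at least 1, so C2 = C4 = C5 = 0 will do; for |T| = 1 both informations
vanish. *)

Require Import Defs.
From mathcomp Require Import all_boot all_order all_algebra.
From mathcomp Require Import boolp reals sequences exp.
From mathcomp Require Import ring lra.

Set Implicit Arguments.
Unset Strict Implicit.
Unset Printing Implicit Defensive.

Import Order.TTheory GRing.Theory Num.Theory.

Local Open Scope ring_scope.

(** * Minima over nonzero values, and Lipschitz bounds for x ln x and entropy *)

Lemma min_nz_le (R : realType) (A : finType) (f : A -> R) (a : A) :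
  f a != 0 -> min_nz f <= f a.
Proof. by move=> fa; apply: bigmin_le_cond. Qed.

Lemma min_nz_gt0 (R : realType) (A : finType) (f : A -> R) :
  (forall a, 0 <= f a) -> 0 < min_nz f.
Proof.
by move=> f0; apply: lt_bigmin => // a fa; rewrite lt_neqAle eq_sym fa f0.
Qed.

Lemma min_nz_le1 (R : realType) (A : finType) (f : A -> R) : min_nz f <= 1.
Proof. exact: bigmin_le_id. Qed.

Lemma ln_le_sub1 (R : realType) (x : R) : 0 < x -> ln x <= x - 1.
Proof.
move=> x0; have := @le_ln1Dx R (x - 1); rewrite addrCA subrr addr0; apply; lra.
Qed.

(** Lipschitz constant of x ln x on [0, 1] when only one of the two points is known to be at least
    [c]. The summands bound the two terms of a ln a - b ln b = a ln (a/b) + (a - b) ln b. *)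
Definition xlnx_lip (R : realType) (c : R) : R := c^-1 + ln c^-1.

Lemma ln_inv_ge0 (R : realType) (c : R) : 0 < c -> c <= 1 -> 0 <= ln c^-1.
Proof. by move=> c0 c1; rewrite lnV ?posrE// oppr_ge0 ln_le0. Qed.

Lemma xlnx_lip_ge0 (R : realType) (c : R) :
  0 < c -> c <= 1 -> 0 <= xlnx_lip c.
Proof. by move=> c0 c1; rewrite addr_ge0 ?invr_ge0 ?(ltW c0) ?ln_inv_ge0. Qed.

Lemma norm_xlnx_le (R : realType) (c b : R) :
  0 < c -> c <= b -> b <= 1 -> `|b * ln b| <= b * ln c^-1.
Proof.
move=> c0 cb b1; have b0 : 0 < b by apply: lt_le_trans cb.
rewrite normrM (gtr0_norm b0) ler_pM2l// ler0_norm ?ln_le0//.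
by rewrite lnV ?posrE// lerN2 ler_ln.
Qed.

(** The slope of x ln x is unbounded near 0 and [a] may lie there, so the splitting evaluates the
    bare logarithm at [b] only. The remaining term a ln (a/b) lies between a - b and (a/b)(a - b),
    by ln x <= x - 1 applied to b/a and a/b. *)
Lemma xlnx_lipP (R : realType) (c a b : R) :
  0 < c -> c <= b -> b <= 1 -> 0 <= a -> a <= 1 ->
  `|a * ln a - b * ln b| <= xlnx_lip c * `|a - b|.
Proof.
move=> c0 cb b1 a0 a1; have b0 : 0 < b by apply: lt_le_trans cb.
have c1 : c <= 1 by apply: le_trans b1.
have lc := ln_inv_ge0 c0 c1.
have ic : 1 <= c^-1 by rewrite invf_ge1.
(* The splitting needs a > 0; at a = 0 the difference is just b ln b. *)
have [->|an0] := eqVneq a 0.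
  rewrite mul0r !sub0r !normrN (gtr0_norm b0).
  apply: le_trans (norm_xlnx_le c0 cb b1) _.
  by rewrite mulrC ler_pM2r// lerDr ltW// invr_gt0.
have {an0} a0 : 0 < a by rewrite lt_neqAle eq_sym an0.
have -> : a * ln a - b * ln b = (a - b) * ln b + a * ln (a / b).
  by rewrite ln_div ?posrE//; ring.
rewrite /xlnx_lip [leRHS]mulrDl [leRHS]addrC.
apply: le_trans (ler_normD _ _) _; apply: lerD.
  rewrite normrM mulrC ler_wpM2r// ler0_norm ?ln_le0//.
  by rewrite lnV ?posrE// lerN2 ler_ln.
rewrite ler_norml; apply/andP; split.
  have : ln (b / a) <= b / a - 1 by apply: ln_le_sub1; rewrite divr_gt0.
  rewrite -(ler_pM2l a0) mulrBr mulr1 mulrCA divff ?gt_eqF// mulr1.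
  rewrite !ln_div ?posrE// => ub; rewrite lerNl.
  apply: (@le_trans _ _ `|a - b|); last by rewrite ler_peMl.
  rewrite distrC; apply: le_trans (ler_norm _); lra.
have [ab|/ltW ab] := leP a b.
  apply: (@le_trans _ _ 0); last by rewrite mulr_ge0 ?invr_ge0// ltW.
  by rewrite mulr_ge0_le0 ?(ltW a0)// ln_le0// ler_pdivrMr// mul1r.
have : ln (a / b) <= a / b - 1 by apply: ln_le_sub1; rewrite divr_gt0.
rewrite -(ler_pM2l a0) => /le_trans; apply.
have -> : a / b - 1 = b^-1 * (a - b) by field; rewrite gt_eqF.
rewrite ger0_norm ?subr_ge0// mulrA ler_wpM2r ?subr_ge0//.
rewrite -[leRHS]mul1r ler_pM ?invr_ge0 ?(ltW a0) ?(ltW b0)//.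
by rewrite lef_pV2.
Qed.

(** Only [g] is bounded below on its support. Where [g] vanishes so does [f], and those atoms
    contribute nothing. *)
Lemma entropy_lip (R : realType) (A : finType) (c : R) (f g : A -> R) :
  0 < c -> (forall a, g a != 0 -> c <= g a) ->
  (forall a, 0 <= f a <= 1) -> (forall a, g a <= 1) ->
  (forall a, g a = 0 -> f a = 0) ->
  `|entropy g - entropy f| <= xlnx_lip c * \sum_a `|f a - g a|.
Proof.
move=> c0 gc f01 g1 ac; rewrite /entropy opprK addrC -sumrB mulr_sumr.
apply: le_trans (ler_norm_sum _ _ _) _; apply: ler_sum => a _.
have [ga0|ga0] := eqVneq (g a) 0.
  by rewrite ga0 ac// subrr normr0 subrr normr0 mulr0.
by have /andP[? ?] := f01 a; apply: xlnx_lipP => //; apply: gc.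
Qed.

Lemma norm_entropy_le (R : realType) (A : finType) (c : R) (g : A -> R) :
  0 < c -> c <= 1 -> (forall a, g a != 0 -> c <= g a) ->
  (forall a, 0 <= g a <= 1) -> \sum_a g a <= 1 ->
  `|entropy g| <= ln c^-1.
Proof.
move=> c0 c1 gc g01 gs; rewrite /entropy normrN.
apply: le_trans (ler_norm_sum _ _ _) _.
apply: (@le_trans _ _ ((\sum_a g a) * ln c^-1)); last first.
  by rewrite -[leRHS]mul1r ler_wpM2r ?ln_inv_ge0.
rewrite mulr_suml; apply: ler_sum => a _; have /andP[ga0 ga1] := g01 a.
have [->|gn0] := eqVneq (g a) 0; first by rewrite !mul0r normr0.
by apply: norm_xlnx_le => //; apply: gc.
Qed.

(** Each row of [w] has total mass 1, so exchanging the sums loses nothing after the triangle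
    inequality. This is what makes the final bound uniform over encoders. *)
Lemma encoder_contract (R : realType) (X T : finType) (w : X -> T -> R)
    (u : X -> R) :
  is_encoder w -> \sum_t `|\sum_x u x * w x t| <= \sum_x `|u x|.
Proof.
move=> we; apply: (@le_trans _ _ (\sum_t \sum_x `|u x| * w x t)).
  apply: ler_sum => t _; apply: le_trans (ler_norm_sum _ _ _) _.
  apply: ler_sum => x _; have [w0 _] := we x.
  by rewrite normrM (ger0_norm (w0 t)).
rewrite exchange_big; apply: ler_sum => x _.
by have [_ w1] := we x; rewrite -mulr_sumr w1 mulr1.
Qed.

(** * Laws of T induced by a joint law and an encoder *)

Section Laws.
Variables (R : realType) (X Y T : finType).
Implicit Types (p q : X * Y -> R) (w : X -> T -> R).

Lemma margX_ge0 p x : is_distr p -> 0 <= margX p x.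
Proof. by case=> p0 _; apply: sumr_ge0. Qed.

Lemma margY_ge0 p y : is_distr p -> 0 <= margY p y.
Proof. by case=> p0 _; apply: sumr_ge0. Qed.

Lemma sum_margX p : is_distr p -> \sum_x margX p x = 1.
Proof. by case=> _ <-; rewrite pair_bigA; apply: eq_bigr => -[]. Qed.

Lemma margY_eq0 p y x : is_distr p -> margY p y = 0 -> p (x, y) = 0.
Proof.
case=> p0 _ /eqP; rewrite psumr_eq0//.
by move=> /allP/(_ x); rewrite mem_index_enum => /(_ isT)/eqP.
Qed.

Lemma margX_eq0 p y x : is_distr p -> margX p x = 0 -> p (x, y) = 0.
Proof.
case=> p0 _ /eqP; rewrite psumr_eq0//.
by move=> /allP/(_ y); rewrite mem_index_enum => /(_ isT)/eqP.
Qed.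

Lemma condTY_ge0 p w t y : is_distr p -> is_encoder w -> 0 <= condTY p w t y.
Proof.
move=> pd we; apply: sumr_ge0 => x _; have [w0 _] := we x.
by rewrite mulr_ge0// divr_ge0 ?margY_ge0//; case: pd.
Qed.

(** Equality fails when p(y) = 0: division by 0 then makes the conditional law identically 0. *)
Lemma sum_condTY_le1 p w y :
  is_distr p -> is_encoder w -> \sum_t condTY p w t y <= 1.
Proof.
move=> pd we; rewrite exchange_big/=.
under eq_bigr => x _ do rewrite -mulr_suml (we x).2 mul1r.
rewrite -mulr_suml -/(margY p y).
by have [->|n0] := eqVneq (margY p y) 0; rewrite ?mul0r// divff.
Qed.

Lemma condTY_le1 p w t y : is_distr p -> is_encoder w -> condTY p w t y <= 1.
Proof.
move=> pd we; apply: le_trans (sum_condTY_le1 y pd we).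
by rewrite (bigD1 t)//= lerDl sumr_ge0// => *; apply: condTY_ge0.
Qed.

Lemma lawT_ge0 p w t : is_distr p -> is_encoder w -> 0 <= lawT p w t.
Proof.
move=> pd we; apply: sumr_ge0 => x _; have [w0 _] := we x.
by rewrite mulr_ge0// margX_ge0.
Qed.

Lemma sum_lawT p w : is_distr p -> is_encoder w -> \sum_t lawT p w t = 1.
Proof.
move=> pd we; rewrite exchange_big/= -(sum_margX pd).
by apply: eq_bigr => x _; rewrite -mulr_suml (we x).2 mul1r.
Qed.

Lemma lawT_le1 p w t : is_distr p -> is_encoder w -> lawT p w t <= 1.
Proof.
move=> pd we; rewrite -(sum_lawT pd we).
by rewrite (bigD1 t)//= lerDl sumr_ge0// => *; apply: lawT_ge0.
Qed.

Lemma jointYT_condTY p w y t :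
  is_distr p -> jointYT p w y t = margY p y * condTY p w t y.
Proof.
move=> pd; rewrite /condTY mulr_sumr; apply: eq_bigr => x _.
rewrite /condXY; have [m0|m0] := eqVneq (margY p y) 0.
  by rewrite (margY_eq0 _ pd m0) m0 !mul0r.
by field.
Qed.

Lemma sum_jointYT_T p w y : is_encoder w -> \sum_t jointYT p w y t = margY p y.
Proof.
move=> we; rewrite exchange_big; apply: eq_bigr => x _.
by rewrite -mulr_sumr (we x).2 mulr1.
Qed.

Lemma sum_jointYT_Y p w t : \sum_y jointYT p w y t = lawT p w t.
Proof.
rewrite exchange_big; apply: eq_bigr => x _.
by rewrite -mulr_suml mulrC.
Qed.

Lemma jointYT_ge0 p w y t : is_distr p -> is_encoder w -> 0 <= jointYT p w y t.
Proof.
move=> pd we; rewrite jointYT_condTY// mulr_ge0 ?margY_ge0//.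
exact: condTY_ge0.
Qed.

Lemma I_YT_entropy p w :
  is_distr p -> is_encoder w -> I_YT p w = H_T p w - H_TY p w.
Proof.
move=> pd we; rewrite /I_YT /mutual_info /H_T /H_TY /entropy.
have -> : \sum_t lawT p w t * ln (lawT p w t)
        = \sum_y \sum_t jointYT p w y t * ln (lawT p w t).
  rewrite exchange_big; apply: eq_bigr => t _.
  by rewrite -mulr_suml sum_jointYT_Y.
rewrite -sumrN -sumrB; apply: eq_bigr => y _.
rewrite mulrN opprK mulr_sumr -sumrN -big_split; apply: eq_bigr => t _ /=.
rewrite sum_jointYT_T// sum_jointYT_Y mulrA -jointYT_condTY// -mulrN -mulrDr.
(* Atoms of zero joint mass contribute 0 on both sides; on the others p(t), p(y) and p(t|y) are
   positive and the logarithm of the quotient splits. *)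
have [->|j0] := eqVneq (jointYT p w y t) 0; first by rewrite !mul0r.
have jp : 0 < jointYT p w y t by rewrite lt_neqAle eq_sym j0 jointYT_ge0.
have tp : 0 < lawT p w t.
  apply: lt_le_trans jp _; rewrite -sum_jointYT_Y (bigD1 y)//= lerDl.
  by rewrite sumr_ge0// => *; apply: jointYT_ge0.
have := jp; rewrite jointYT_condTY// => jp'.
have yp : 0 < margY p y.
  rewrite lt_neqAle margY_ge0// andbT eq_sym.
  by apply/eqP => m0; rewrite m0 mul0r ltxx in jp'.
have cp : 0 < condTY p w t y by rewrite pmulr_rgt0 in jp'.
congr (_ * _); rewrite addrC -ln_div ?posrE//; congr ln.
by field; rewrite !gt_eqF.
Qed.

(** Here sqrt(|T| - 1) is 0, so the difference of informations has to vanish exactly. The only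
    encoder is constantly 1, hence T is independent of Y. *)
Lemma I_YT_card_le1 p w :
  is_distr p -> is_encoder w -> (#|T| <= 1)%N -> I_YT p w = 0.
Proof.
move=> pd we T1; have w1 x t : w x t = 1.
  rewrite -(we x).2 (bigD1 t)//= big1 ?addr0// => t' tt'.
  by rewrite (fintype_le1P T1 t' t) eqxx in tt'.
apply: big1 => y _; apply: big1 => t _.
rewrite sum_jointYT_T// sum_jointYT_Y.
have -> : lawT p w t = 1.
  by rewrite -(sum_margX pd); apply: eq_bigr => x _; rewrite w1 mul1r.
have -> : jointYT p w y t = margY p y.
  by apply: eq_bigr => x _; rewrite w1 mulr1.
rewrite mulr1; have [->|m0] := eqVneq (margY p y) 0; first by rewrite mul0r.
by rewrite divff// ln1 mulr0.
Qed.

(** * Stability of marginals and entropies in the l1 distance of joint laws *)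

Lemma dist_margX p q :
  \sum_x `|margX q x - margX p x| <= \sum_z `|q z - p z|.
Proof.
rewrite [leRHS](_ : _ = \sum_x \sum_y `|q (x, y) - p (x, y)|); last first.
  by rewrite pair_bigA; apply: eq_bigr => -[].
by apply: ler_sum => x _; rewrite -sumrB; apply: ler_norm_sum.
Qed.

Lemma dist_margY p q :
  \sum_y `|margY q y - margY p y| <= \sum_z `|q z - p z|.
Proof.
rewrite [leRHS](_ : _ = \sum_y \sum_x `|q (x, y) - p (x, y)|); last first.
  by rewrite exchange_big pair_bigA; apply: eq_bigr => -[].
by apply: ler_sum => x _; rewrite -sumrB; apply: ler_norm_sum.
Qed.

Lemma dist_lawT p q w :
  is_encoder w -> \sum_t `|lawT q w t - lawT p w t| <= \sum_z `|q z - p z|.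
Proof.
move=> we; apply: le_trans (dist_margX p q).
apply: le_trans (encoder_contract (fun x => margX q x - margX p x) we).
apply: ler_sum => t _; rewrite le_eqVlt; apply/orP; left; apply/eqP.
by congr (`|_|); rewrite -sumrB; apply: eq_bigr => x _; ring.
Qed.

(* p(y) may be arbitrarily small, so the empirical p(t|y) need not be close to
p(t|y); it is once weighted by the empirical p(y). *)
Lemma dist_condTY p q w y :
  is_distr p -> is_distr q -> is_encoder w ->
  margY q y * \sum_t `|condTY q w t y - condTY p w t y|
  <= \sum_x `|q (x, y) - p (x, y)| + `|margY q y - margY p y|.
Proof.
move=> pd qd we; rewrite mulr_sumr.
apply: (@le_trans _ _ (\sum_t (`|jointYT q w y t - jointYT p w y t|
   + condTY p w t y * `|margY q y - margY p y|))).
  apply: ler_sum => t _; have c0 := condTY_ge0 t y pd we.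
  rewrite -{1}(ger0_norm (margY_ge0 y qd)) -normrM.
  rewrite -{2}(ger0_norm c0) -normrM !jointYT_condTY//.
  rewrite [X in `|X|](_ : _ = (margY q y * condTY q w t y
     - margY p y * condTY p w t y)
     - condTY p w t y * (margY q y - margY p y)); last by ring.
  exact: ler_normB.
rewrite big_split/= lerD//.
  apply: le_trans (encoder_contract (fun x => q (x, y) - p (x, y)) we).
  apply: ler_sum => t _; rewrite -sumrB le_eqVlt; apply/orP; left; apply/eqP.
  by congr (`|_|); apply: eq_bigr => x _; rewrite mulrBl.
by rewrite -mulr_suml -[leRHS]mul1r ler_wpM2r// sum_condTY_le1.
Qed.

Lemma dist_H_T p q w :
  is_distr p -> is_distr q -> (forall z, p z = 0 -> q z = 0) -> is_encoder w ->
  `|H_T p w - H_T q w|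
  <= xlnx_lip (min_nz (lawT p w)) * \sum_z `|q z - p z|.
Proof.
move=> pd qd ac we.
have c0 : 0 < min_nz (lawT p w) by apply: min_nz_gt0 => t; apply: lawT_ge0.
apply: (@le_trans _ _ (xlnx_lip (min_nz (lawT p w))
    * \sum_t `|lawT q w t - lawT p w t|)); last first.
  by rewrite ler_wpM2l ?xlnx_lip_ge0 ?min_nz_le1// dist_lawT.
apply: entropy_lip => // t.
- exact: min_nz_le.
- by rewrite lawT_ge0// lawT_le1.
- exact: lawT_le1.
(* Absolute continuity passes to T: p(t) = 0 kills every nonnegative term p(x,y)p(t|x), hence every
   q(x,y)p(t|x). *)
rewrite -!(sum_jointYT_Y _ w t) => /eqP.
rewrite psumr_eq0; last by move=> *; apply: jointYT_ge0.
move=> /allP j0; apply: big1 => y _; have := j0 y.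
rewrite mem_index_enum => /(_ isT)/=.
rewrite psumr_eq0; last first.
  by move=> x _; rewrite mulr_ge0//; [case: pd|case: (we x)].
move=> /allP jx; apply: big1 => x _; have := jx x.
rewrite mem_index_enum => /(_ isT)/=.
rewrite mulf_eq0 => /orP[/eqP/ac->|/eqP->].
  by rewrite mul0r.
by rewrite mulr0.
Qed.

Lemma condTY_eq0 p q w t y :
  is_distr p -> is_distr q -> (forall z, p z = 0 -> q z = 0) -> is_encoder w ->
  condTY p w t y = 0 -> condTY q w t y = 0.
Proof.
move=> pd qd ac we /eqP; rewrite psumr_eq0; last first.
  move=> x _; rewrite mulr_ge0 ?divr_ge0 ?margY_ge0//; first by case: (we x).
  by case: pd.
move=> /allP cx; apply: big1 => x _; have := cx x.
rewrite mem_index_enum => /(_ isT)/=.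
rewrite /condXY !mulf_eq0 invr_eq0 => /or3P[/eqP->|/eqP/ac->|/eqP m0].
- by rewrite mul0r.
- by rewrite mul0r mulr0.
by rewrite (ac _ (margY_eq0 x pd m0)) mul0r mulr0.
Qed.

(** Changing p(y) to q(y) costs |p(y) - q(y)| times H(T|y), and H(T|y) is at most ln(1/b) whatever
    the size of T. Changing the conditional law is then weighted by q(y), as [dist_condTY] requires;
    its two error terms each sum to at most the l1 distance, whence the factor 2. *)
Lemma dist_H_TY p q w (b := min_nz (fun z : T * Y => condTY p w z.1 z.2)) :
  is_distr p -> is_distr q -> (forall z, p z = 0 -> q z = 0) -> is_encoder w ->
  `|H_TY p w - H_TY q w|
  <= (ln b^-1 + 2 * xlnx_lip b) * \sum_z `|q z - p z|.
Proof.
move=> pd qd ac we.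
have c0 : 0 < b by apply: min_nz_gt0 => z; apply: condTY_ge0.
have c1 : b <= 1 by apply: min_nz_le1.
have cb y t : condTY p w t y != 0 -> b <= condTY p w t y.
  exact: (@min_nz_le _ _ (fun z : T * Y => condTY p w z.1 z.2) (t, y)).
have c01 p' y t : is_distr p' -> 0 <= condTY p' w t y <= 1.
  by move=> ?; rewrite condTY_ge0// condTY_le1.
rewrite -sumrB; apply: le_trans (ler_norm_sum _ _ _) _.
pose N y : R := \sum_x `|q (x, y) - p (x, y)|.
pose M y : R := `|margY q y - margY p y|.
apply: (@le_trans _ _ (\sum_y (M y * ln b^-1 + xlnx_lip b * (N y + M y)))).
  apply: ler_sum => y _.
  set e := entropy _; set f := entropy _.
  rewrite [X in `|X|](_ : _ = (margY p y - margY q y) * e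
     + margY q y * (e - f)); last by ring.
  apply: le_trans (ler_normD _ _) _; apply: lerD.
    rewrite normrM distrC ler_wpM2l//; apply: norm_entropy_le => //.
    - exact: cb.
    - by move=> t; apply: c01.
    exact: sum_condTY_le1.
  rewrite normrM (ger0_norm (margY_ge0 y qd)).
  apply: (@le_trans _ _ (margY q y * (xlnx_lip b
      * \sum_t `|condTY q w t y - condTY p w t y|))).
    rewrite ler_wpM2l ?margY_ge0//; apply: entropy_lip => //.
    - exact: cb.
    - by move=> t; apply: c01.
    - by move=> t; case/andP: (c01 p y t pd).
    by move=> t; apply: condTY_eq0.
  by rewrite mulrCA ler_wpM2l ?xlnx_lip_ge0// dist_condTY.
rewrite big_split/= -mulr_suml -mulr_sumr big_split/=.
have -> : \sum_y N y = \sum_z `|q z - p z|.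
  by rewrite exchange_big pair_bigA; apply: eq_bigr => -[].
have := dist_margY p q; rewrite -/(M _) => dM.
have l0 := ln_inv_ge0 c0 c1; have x0 := xlnx_lip_ge0 c0 c1.
rewrite [leRHS]mulrDl mulrC; apply: lerD; first by rewrite ler_wpM2l.
by rewrite -mulrA mulrCA ler_wpM2l// mulr_natl mulr2n lerD2l.
Qed.

(** An atom (x,y) has p(x) at least the minimum, so it is charged p(x)/min >= 1; summing over x
    gives 1/min for each y. *)
Lemma card_support_le p :
  is_distr p -> \sum_(z | p z != 0) 1 <= #|Y|%:R / min_nz (margX p).
Proof.
move=> pd; have c0 : 0 < min_nz (margX p).
  by apply: min_nz_gt0 => x; apply: margX_ge0.
apply: (@le_trans _ _ (\sum_y \sum_x margX p x / min_nz (margX p))).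
  rewrite exchange_big pair_bigA big_mkcond/=; apply: ler_sum => -[x y] _ /=.
  case: ifPn => [pn0|_]; last by rewrite divr_ge0 ?margX_ge0// ltW.
  rewrite ler_pdivlMr// mul1r; apply: min_nz_le.
  by apply: contra_neq pn0; apply: margX_eq0.
rewrite sumr_const -mulr_suml sum_margX// mul1r -[leLHS]mulr_natl; exact: lexx.
Qed.

End Laws.

(** * I.i.d. samples: second moment of the empirical law and Markov's inequality *)

Section IidSample.
Variables (R : realType) (A : finType) (p : A -> R) (m : nat).
Hypothesis pd : is_distr p.
Implicit Type s : {ffun 'I_m -> A}.

Let wt s : R := \prod_(i < m) p (s i).

Lemma iid_weight_ge0 s : 0 <= wt s.
Proof. by apply: prodr_ge0 => i _; case: pd. Qed.

Lemma sum_iid_weight : \sum_s wt s = 1.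
Proof.
rewrite /wt -(bigA_distr_bigA (fun _ => p)) big1// => i _.
by case: pd.
Qed.

Lemma iid_expect_prod (g : 'I_m -> A -> R) :
  \sum_s wt s * (\prod_i g i (s i)) = \prod_i \sum_a p a * g i a.
Proof.
rewrite (bigA_distr_bigA (fun i a => p a * g i a)); apply: eq_bigr => s _.
by rewrite big_split.
Qed.

Lemma iid_expect_mul (g : A -> R) (i j : 'I_m) :
  \sum_a p a * g a = 0 ->
  \sum_s wt s * (g (s i) * g (s j)) =
    if i == j then \sum_a p a * g a ^+ 2 else 0.
Proof.
move=> g0.
(* Writes g(s_i) g(s_j) as a product over all coordinates, including i = j, so that the expectation
   factorizes. *)
pose h k a := (if k == i then g a else 1) * (if k == j then g a else 1).
have -> : \sum_s wt s * (g (s i) * g (s j))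
        = \sum_s wt s * \prod_k h k (s k).
  apply: eq_bigr => s _; rewrite big_split/= -!big_mkcond/=.
  by rewrite !big_pred1_eq.
rewrite iid_expect_prod (bigD1 i)//= /h eqxx.
case: eqVneq => [<-|ij].
  under eq_bigr do rewrite -expr2.
  rewrite [X in _ * X]big1 ?mulr1// => k /negPf ki.
  by rewrite ki; under eq_bigr do rewrite !mulr1; case: pd.
by under eq_bigr do rewrite mulr1; rewrite g0 mul0r.
Qed.

Lemma iid_second_moment (g : A -> R) :
  \sum_a p a * g a = 0 ->
  \sum_s wt s * (\sum_i g (s i)) ^+ 2 = m%:R * \sum_a p a * g a ^+ 2.
Proof.
move=> g0.
under eq_bigr => s _ do
  (rewrite expr2 mulr_suml mulr_sumr;
   under eq_bigr => i _ do rewrite mulr_sumr mulr_sumr).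
rewrite exchange_big/=; under eq_bigr => i _.
  rewrite exchange_big/=; under eq_bigr => j _ do rewrite iid_expect_mul//.
  rewrite -big_mkcond (eq_bigl (pred1 i)) ?big_pred1_eq; last first.
    by move=> j; rewrite /= eq_sym.
  over.
by rewrite sumr_const card_ord mulr_natl.
Qed.

Lemma empiricalE s a :
  empirical R s a = m%:R^-1 * \sum_i (s i == a)%:R.
Proof.
rewrite /empirical mulrC; congr (_ * _); rewrite -sum1_card natr_sum big_mkcond.
by apply: eq_bigr => i _; rewrite inE; case: (s i == a).
Qed.

(** The count of each atom a is binomial, so its frequency has variance p(a)(1 - p(a))/m <= p(a)/m,
    and these bounds sum to 1/m. *)
Lemma iid_empirical_var : (0 < m)%N ->
  \sum_s wt s * (\sum_a (empirical R s a - p a) ^+ 2) <= m%:R^-1.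
Proof.
move=> m0; have mn0 : m%:R != 0 :> R by rewrite pnatr_eq0 -lt0n.
have [p0 p1] := pd.
under eq_bigr do rewrite mulr_sumr.
rewrite exchange_big/= -[leRHS]mulr1 -[X in _ <= _ * X]p1 mulr_sumr.
apply: ler_sum => a _.
(* The centered indicator of a; the deviation at a is the sample mean of [g]. *)
pose g b : R := (b == a)%:R - p a.
have sp f : \sum_b p b * ((b == a)%:R * f b) = p a * f a.
  rewrite (bigD1 a)//= eqxx mul1r big1 ?addr0// => b /negPf->.
  by rewrite mul0r mulr0.
have g0 : \sum_b p b * g b = 0.
  under eq_bigr do rewrite mulrBr.
  rewrite sumrB -mulr_suml p1.
  by have := sp (fun=> 1); under eq_bigr do rewrite mulr1; move=> ->; ring.
have -> : \sum_s wt s * (empirical R s a - p a) ^+ 2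
        = m%:R^-1 ^+ 2 * \sum_s wt s * (\sum_i g (s i)) ^+ 2.
  rewrite mulr_sumr; apply: eq_bigr => s _.
  rewrite empiricalE sumrB sumr_const card_ord -mulr_natl; field.
  exact: mn0.
rewrite iid_second_moment//.
have -> : \sum_b p b * g b ^+ 2 = p a - p a ^+ 2.
  have := sp (fun b => 1 - p a *+ 2); rewrite -[X in _ -> _ = X]addr0.
  have -> : \sum_b p b * g b ^+ 2 = \sum_b p b * ((b == a)%:R * (1 - p a *+ 2))
      + \sum_b p b * p a ^+ 2.
    rewrite -big_split; apply: eq_bigr => b _ /=; rewrite /g.
    by case: (b == a) => /=; ring.
  by move=> ->; rewrite -mulr_suml p1; ring.
have -> : m%:R^-1 ^+ 2 * (m%:R * (p a - p a ^+ 2)) = m%:R^-1 * (p a - p a ^+ 2).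
  by field.
by rewrite ler_wpM2l ?invr_ge0// gerBl sqr_ge0.
Qed.

Lemma iid_weight_supp s z : p z = 0 -> empirical R s z != 0 -> wt s = 0.
Proof.
move=> pz; rewrite /empirical => e0.
have /card_gt0P[i] : (0 < #|[set i | s i == z]|)%N.
  by rewrite lt0n; apply: contra_neq e0 => ->; rewrite mul0r.
by rewrite inE => /eqP si; rewrite /wt (bigD1 i)//= si pz mul0r.
Qed.

(** Markov's inequality for the squared l2 distance, whose mean is at most 1/m. Samples hitting a
    null atom of [p] have weight 0, so [E] need only be proved for absolutely continuous empirical
    laws. *)
Lemma iid_pr_chebyshev (delta : R) (E : {ffun 'I_m -> A} -> Prop) :
  0 < delta -> (0 < m)%N ->
  (forall s, (forall z, p z = 0 -> empirical R s z = 0) ->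
     \sum_a (empirical R s a - p a) ^+ 2 <= (m%:R * delta)^-1 -> E s) ->
  1 - delta <= iid_pr p E.
Proof.
move=> d0 m0 HE; have mp : 0 < m%:R :> R by rewrite ltr0n.
rewrite -sum_iid_weight (bigID (fun s => `[< E s >]))/= lerBlDr lerD2l.
apply: (@le_trans _ _ (\sum_s (m%:R * delta)
    * (wt s * (\sum_a (empirical R s a - p a) ^+ 2)))).
  rewrite big_mkcond/=; apply: ler_sum => s _; set N := \sum_a _.
  have N0 : 0 <= N by apply: sumr_ge0 => *; apply: sqr_ge0.
  have w0 := iid_weight_ge0 s.
  case: ifPn => [/asboolPn nE|_]; last by rewrite !mulr_ge0// ltW.
  have [->|wn0] := eqVneq (wt s) 0; first by rewrite mul0r mulr0.
  (* For a sample of positive weight outside [E], the factor m delta N is at least 1. *)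
  rewrite mulrCA ler_peMr//.
  have [Ns|Ns] := leP N (m%:R * delta)^-1; last first.
    by rewrite -ler_pdivrMl ?mulr_gt0// mulr1 ltW.
  case: nE; apply: HE => // z pz; apply/eqP; apply: contraT => /iid_weight_supp.
  by move=> /(_ pz) w00; rewrite w00 eqxx in wn0.
rewrite -mulr_sumr -[leRHS](@mulfK _ m%:R) ?gt_eqF// [delta * _]mulrC.
by rewrite ler_wpM2l ?iid_empirical_var// mulr_ge0 ?ltW.
Qed.

Lemma empirical_distr s : (0 < m)%N -> is_distr (empirical R s).
Proof.
move=> m0; split=> [a|]; first by rewrite divr_ge0.
under eq_bigr do rewrite empiricalE.
rewrite -mulr_sumr exchange_big/=.
under eq_bigr => i _.
  rewrite (bigD1 (s i))//= eqxx big1 ?addr0; last first.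
    by move=> a /negPf; rewrite eq_sym => ->.
  over.
by rewrite sumr_const card_ord mulVf// pnatr_eq0 -lt0n.
Qed.

End IidSample.

(** * From l2 to l1 deviation, and the final bound *)

(* AM-GM on each atom: 2 |u| <= k u^2 + 1/k. *)
Lemma l1_le_l2 (R : realType) (A : finType) (k : R) (p q : A -> R) :
  0 < k -> (forall a, p a = 0 -> q a = 0) ->
  \sum_a `|q a - p a|
  <= (k * \sum_a (q a - p a) ^+ 2 + k^-1 * \sum_(a | p a != 0) 1) / 2.
Proof.
move=> k0 ac.
rewrite [X in k^-1 * X]big_mkcond/= !mulr_sumr -big_split/= mulr_suml.
apply: ler_sum => a _; case: eqVneq => [pa|_] /=.
  by rewrite pa ac// subr0 normr0 expr0n !mulr0 add0r mul0r.
have -> : (q a - p a) ^+ 2 = `|q a - p a| ^+ 2 by rewrite real_normK ?num_real.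
set u := `|_|; rewrite mulr1 ler_pdivlMr// -subr_ge0.
have -> : k * u ^+ 2 + k^-1 - u * 2 = k^-1 * (k * u - 1) ^+ 2.
  by field; rewrite gt_eqF.
by rewrite mulr_ge0 ?invr_ge0 ?sqr_ge0// ltW.
Qed.

(* [l1_le_l2] at [k = sqrt m], with squared l2 distance at most 1/(m delta) and
at most |Y| / min p(x) atoms. *)
Definition l1_dev (R : realType) (delta : R) (nY : nat) (mu : R) : R :=
  (delta^-1 + nY%:R / mu) / 2.

Lemma empirical_l1_dev (R : realType) (X Y : finType) (p q : X * Y -> R)
    (delta : R) (m : nat) :
  is_distr p -> (0 < m)%N -> (forall z, p z = 0 -> q z = 0) ->
  \sum_z (q z - p z) ^+ 2 <= (m%:R * delta)^-1 ->
  \sum_z `|q z - p z|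
  <= (Num.sqrt m%:R)^-1 * l1_dev delta #|Y| (min_nz (margX p)).
Proof.
move=> pd m0 ac dq; set r := Num.sqrt m%:R.
have r0 : 0 < r by rewrite sqrtr_gt0 ltr0n.
have rr : m%:R = r * r :> R by rewrite -expr2 sqr_sqrtr.
apply: le_trans (l1_le_l2 r0 ac) _.
rewrite /l1_dev mulrA ler_wpM2r ?invr_ge0// mulrDr; apply: lerD.
  apply: le_trans (ler_wpM2l (ltW r0) dq) _.
  by rewrite rr !invfM -mulrA mulVKf ?gt_eqF.
by rewrite ler_wpM2l ?invr_ge0 ?(ltW r0)// card_support_le.
Qed.

Theorem theorem3 (R : realType) :
  exists C1 C2 C3 C4 C5 : R -> nat -> R -> R -> R -> R -> R,
  forall (X Y : finType) (p : X * Y -> R) (delta : R) (m : nat),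
    is_distr p -> 0 < delta -> delta < 1 -> (0 < m)%N ->
    1 - delta <=
    iid_pr p (fun s : {ffun 'I_m -> X * Y} =>
      forall (T : finType) (w : X -> T -> R),
        is_encoder w ->
        sample_size_ok p w (dev delta #|Y| m) ->
        let phat : X * Y -> R := empirical R s in
        let K (C : R -> nat -> R -> R -> R -> R -> R) : R :=
          C delta #|Y|
            (min_nz (fun z : X * Y => condXY p z.1 z.2))
            (min_nz (fun z : T * Y => condTY p w z.1 z.2))
            (min_nz (margX p))
            (min_nz (lawT p w)) in
        `|I_YT p w - I_YT phat w| <=
        (Num.sqrt m%:R)^-1 *
        ((K C1 + K C3) * Num.sqrt (#|T|%:R - 1)
         + K C2 * H_T p w
         + K C4 * H_TY p w
         + K C5 * Num.sqrt ((ln #|T|%:R - H_TY phat w) * H_TY phat w))).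
Proof.
(* [C1] carries the error on H(T) and [C3] the error on H(T|Y): each is a Lipschitz constant times
   the scaled l1 deviation. *)
exists (fun delta nY b beta mu tau => xlnx_lip tau * l1_dev delta nY mu).
exists (fun _ _ _ _ _ _ => 0).
exists (fun delta nY b beta mu tau =>
  (ln beta^-1 + 2 * xlnx_lip beta) * l1_dev delta nY mu).
exists (fun _ _ _ _ _ _ => 0); exists (fun _ _ _ _ _ _ => 0).
move=> X Y p delta m pd d0 _ m0.
apply: iid_pr_chebyshev => // s ac dev2 T w we _.
set q := empirical R s ; have qd : is_distr q by apply: empirical_distr.
move=> /=; rewrite !mul0r !addr0.
have [T1|T1] := leqP #|T| 1.
  have sT : Num.sqrt (#|T|%:R - 1) = 0 :> R.
    by apply/eqP; rewrite sqrtr_eq0 subr_le0 (ler_nat R _ 1).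
  by rewrite !I_YT_card_le1// subrr normr0 sT !mulr0 lexx.
have tau0 : 0 < min_nz (lawT p w) by apply: min_nz_gt0 => t; apply: lawT_ge0.
set beta := min_nz (fun z : T * Y => condTY p w z.1 z.2).
have beta0 : 0 < beta by apply: min_nz_gt0 => z; apply: condTY_ge0.
have L1 := xlnx_lip_ge0 tau0 (min_nz_le1 _).
have L2 := xlnx_lip_ge0 beta0 (min_nz_le1 _).
have L3 := ln_inv_ge0 beta0 (min_nz_le1 _).
have qp := empirical_l1_dev pd m0 ac dev2.
(* With at least two letters S >= 1, so the dimension-free bound may be multiplied by [S]. *)
set S := Num.sqrt (#|T|%:R - 1).
have S1 : 1 <= S.
  by rewrite -sqrtr1 ler_wsqrtr// lerBrDr -[leLHS](natrD _ 1 1) ler_nat.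
rewrite !I_YT_entropy//.
have -> : H_T p w - H_TY p w - (H_T q w - H_TY q w)
  = (H_T p w - H_T q w) - (H_TY p w - H_TY q w) by ring.
apply: le_trans (ler_normB _ _) _.
apply: le_trans (lerD (dist_H_T pd qd ac we) (dist_H_TY pd qd ac we)) _.
rewrite -mulrDl; set L := _ + _.
have L0 : 0 <= L.
  by apply: addr_ge0 => //; apply: addr_ge0 => //; apply: mulr_ge0.
apply: le_trans (ler_wpM2l L0 qp) _.
rewrite -mulrDl -/L mulrCA ler_wpM2l ?invr_ge0 ?sqrtr_ge0//.
rewrite ler_peMr// mulr_ge0//.
(* [l1_dev] is nonnegative because, scaled by a positive factor, it dominates an l1 distance. *)
have : 0 < (Num.sqrt m%:R)^-1 :> R by rewrite invr_gt0 sqrtr_gt0 ltr0n.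
by move=> /pmulr_rge0 <-; apply: le_trans qp; apply: sumr_ge0.
Qed.
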